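(* Let $d\geqslant 1$ and let $A=\{v_1,\dots,v_{d+2}\}\subset\mathbb{Z}^d$ be a set of $d+2$ points, no $d+1$ of which are contained in the same hyperplane. For $1\leqslant i\leqslant d+2$ let $D_i=\det(\widetilde{v}_1,\dots,\widetilde{v}_{i-1},\widetilde{v}_{i+1},\dots,\widetilde{v}_{d+2})$, let $D=\gcd(D_1,\dots,D_{d+2})$, and let $\Delta_A$ be the convex hull of $A$. Then for every positive integer $h$: $$|hA|=\binom{h+d+1}{d+1}\quad\text{if } 1\leqslant h<\mathrm{vol}(\Delta_A)\,d!/D,$$ and $$|hA|=\binom{h+d+1}{d+1}-\binom{h-\mathrm{vol}(\Delta_A)\,d!/D+d+1}{d+1}\quad\text{if } h\geqslant \mathrm{vol}(\Delta_A)\,d!/D.$$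
   Context: For $A\subset\mathbb{Z}^d$ and a positive integer $h$, the $h$-fold sumset is $hA=\{a_1+\dots+a_h : a_i\in A\}$ (repetitions allowed). For $v=(v^{(1)},\dots,v^{(d)})\in\mathbb{Z}^d$, its lift is $\widetilde{v}=(v^{(1)},\dots,v^{(d)},1)\in\mathbb{Z}^{d+1}$. The determinant of a list of $d+1$ vectors in $\mathbb{Z}^{d+1}$ is the determinant of the matrix having them as columns, in the given order. $\mathrm{vol}$ is the $d$-dimensional Lebesgue volume in $\mathbb{R}^d$, and $\gcd$ is the positive greatest common divisor. ''Hyperplane'' means affine hyperplane of $\mathbb{R}^d$. *)

(* Defs.v *)
From HB Require Import structures.
From mathcomp Require Import all_boot all_order all_algebra finmap.
From mathcomp Require Import all_classical all_reals all_analysis.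

Set Implicit Arguments.
Unset Strict Implicit.
Unset Printing Implicit Defensive.

Import Order.TTheory GRing.Theory Num.Theory.

Local Open Scope classical_set_scope.
Local Open Scope ring_scope.

(* Lebesgue measure on [n.-tuple R]: the [n]-fold product of the Lebesgue
   measure of the line, built one coordinate at a time and transported along
   the isomorphism [tcons] between [R * R^n] and [R^(n+1)]. *)

Section lebesgue_tuple_step.
Context {R : realType} (n : nat).
Local Notation RT := (measurableTypeR R).

Definition tcons (x : RT * n.-tuple RT) : n.+1.-tuple RT :=
  [tuple of x.1 :: x.2].

Definition tuncons (t : n.+1.-tuple RT) : RT * n.-tuple RT :=
  (thead t, [tuple of behead t]).

Lemma tconsK : cancel tcons tuncons.
Proof. by move=> [x t]; congr (_, _); apply/val_inj. Qed.

Lemma tunconsK : cancel tuncons tcons.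
Proof. by move=> t; rewrite [RHS]tuple_eta; apply/val_inj. Qed.

Lemma measurable_tcons : measurable_fun [set: RT * n.-tuple RT] tcons.
Proof. exact: measurable_cons. Qed.

Lemma measurable_tuncons : measurable_fun [set: n.+1.-tuple RT] tuncons.
Proof.
apply/measurable_fun_pairP; split; first exact: measurable_tnth.
exact: measurable_behead.
Qed.

Variable m : {sigma_finite_measure set (n.-tuple RT) -> \bar R}.

Definition lebesgue_cons : set (n.+1.-tuple RT) -> \bar R :=
  pushforward (lebesgue_measure \x m)%E tcons.

Let mtcons : measurable_fun [set: RT * n.-tuple RT] tcons := measurable_tcons.

Let lebesgue_cons0 : lebesgue_cons set0 = 0%E.
Proof. exact: measure0. Qed.

Let lebesgue_cons_ge0 X : (0 <= lebesgue_cons X)%E.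
Proof. exact: measure_ge0. Qed.

Let lebesgue_cons_sigma_additive : semi_sigma_additive lebesgue_cons.
Proof. exact: measure_semi_sigma_additive. Qed.

HB.instance Definition _ := isMeasure.Build _ _ _ lebesgue_cons
  lebesgue_cons0 lebesgue_cons_ge0 lebesgue_cons_sigma_additive.

Let lebesgue_cons_sigma_finite : sigma_finite setT lebesgue_cons.
Proof.
have /sigma_finiteP[F [TF ndF Foo]] := sigma_finiteT (@lebesgue_measure R).
have /sigma_finiteP[G [TG ndG Goo]] := sigma_finiteT m.
exists (fun k => tuncons @^-1` (F k `*` G k)) => [|k].
  rewrite -preimage_bigcup (_ : \bigcup_i _ = setT) ?preimage_setT//.
  apply/seteqP; split=> // -[x t] _.
  have [i _ Fx] : (\bigcup_i F i) x by rewrite -TF.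
  have [j _ Gt] : (\bigcup_i G i) t by rewrite -TG.
  exists (maxn i j) => //; split => /=.
    by move: x Fx; exact/subsetPset/ndF/leq_maxl.
  by move: t Gt; exact/subsetPset/ndG/leq_maxr.
have [[mF Fk] [mG Gk]] := (Foo k, Goo k); split.
  rewrite -[X in measurable X]setTI; apply: measurable_tuncons => //.
  exact: measurableX.
rewrite /lebesgue_cons /pushforward -comp_preimage.
rewrite (_ : tuncons \o tcons = id); last first.
  by apply/funext => x /=; rewrite tconsK.
by rewrite preimage_id product_measure1E// lte_mul_pinfty// ge0_fin_numE.
Qed.

HB.instance Definition _ := Measure_isSigmaFinite.Build _ _ _ lebesgue_cons
  lebesgue_cons_sigma_finite.

End lebesgue_tuple_step.

Fixpoint lebesgue_tuple (R : realType) (n : nat) :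
    {sigma_finite_measure set (n.-tuple (measurableTypeR R)) -> \bar R} :=
  match n with
  | 0 => \d_([tuple] : 0.-tuple (measurableTypeR R))
  | n'.+1 => lebesgue_cons (lebesgue_tuple R n')
  end.

(* Points of R^d and Z^d are column vectors. *)

Definition volume (R : realType) (d : nat) (X : set 'cV[R]_d) : \bar R :=
  lebesgue_tuple R d [set t | X (\col_i tnth t i)].

Definition convex_hull (R : realType) (d : nat) (X : set 'cV[R]_d) :
    set 'cV[R]_d :=
  smallest (@convex_set R 'cV[R]_d) X.

Definition hyperplane (R : realType) (d : nat) (H : set 'cV[R]_d) : Prop :=
  exists (a : 'rV[R]_d) (b : R),
    a != 0 /\ H = [set x | (a *m x) 0 0 = b].

Definition real_points (R : realType) (d : nat) (A : {fset 'cV[int]_d}) :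
    set 'cV[R]_d :=
  [set map_mx intr x | x in [set` A]].
Arguments real_points R [d] A.

Definition sumset (d : nat) (h : nat) (A : {fset 'cV[int]_d}) :
    {fset 'cV[int]_d} :=
  [fset \sum_(i < h) val (a i) | a : {ffun 'I_h -> A} in predT]%fset.

(* The vector [(x, 1)]: [ord_max] is the index of the last coordinate. *)
Definition vlift (d : nat) (x : 'cV[int]_d) : 'cV[int]_d.+1 :=
  \col_k if unlift ord_max k is Some j then x j 0 else 1.

(* [lift i] enumerates in increasing order the indices different from [i]. *)
Definition minor_det (d : nat) (v : 'I_d.+2 -> 'cV[int]_d) (i : 'I_d.+2) : int :=
  \det (\matrix_(k < d.+1, j < d.+1) vlift (v (lift i j)) k 0).

Definition minor_gcd (d : nat) (v : 'I_d.+2 -> 'cV[int]_d) : int :=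
  \big[gcdz/0]_(i < d.+2) minor_det v i.

(* The binomial coefficient [x (x - 1) ... (x - k + 1) / k!] with a real upper
   argument; it is ['C(n, k)] when [x] is the natural number [n]. *)
Definition rbinom (R : realType) (x : R) (k : nat) : R :=
  (\prod_(i < k) (x - i%:R)) / k`!%:R.

(* Main.v *)
(* The lifts of the points satisfy a single linear relation up to scaling: by
   Cramer's rule its coefficients are the signed minors, so it is spanned over
   Z by the primitive vector w with entries (-1)^i D_i / D.  Hence hA is the set
   of compositions x of h into d + 2 parts modulo translation by w.  Each class
   is a finite chain, so the number of classes is the number of x minus the
   number of those from which w can be subtracted; the latter are exactly the
   x >= max(0, w), that is, the compositions of h - N, where N is the sum of the
   positive entries of w.

   Over the reals the same relation triangulates the hull into the simplices
   obtained by dropping a vertex i with w_i > 0: subtract from a convex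
   combination the largest possible multiple of w.  Their interiors are disjoint
   and the i-th one has volume |D_i| / d!, so that vol * d! = D N.  As open and
   closed simplices have the same volume, the null overlaps need no separate
   argument. *)

Require Import Defs.
From mathcomp Require Import all_boot all_order all_algebra finmap.
From mathcomp Require Import all_classical all_reals all_analysis.
From mathcomp Require Import measurable_realfun zify.

Set Implicit Arguments.
Unset Strict Implicit.
Unset Printing Implicit Defensive.

Import Order.TTheory GRing.Theory Num.Theory.

Local Open Scope classical_set_scope.
Local Open Scope ring_scope.

(** * Columns and Lebesgue measure *)

Section measure_columns.
Context {R : realType}.
Local Notation RT := (measurableTypeR R).
Implicit Types n : nat.

Definition col_of_tuple n (t : n.-tuple RT) : 'cV[R]_n := \col_i tnth t i.

(** Columns inherit their sigma-algebra from tuples, where the measure behind [volume] lives. *)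
Definition measurable_cV n (X : set 'cV[R]_n) :=
  measurable [set t | X (col_of_tuple t)].

Lemma measurable_coord n i : measurable_fun setT
  (fun t : n.-tuple RT => (col_of_tuple t) i 0).
Proof.
rewrite (_ : (fun _ => _) = (@tnth _ _)^~ i); first exact: measurable_tnth.
by apply/funext => t; rewrite mxE.
Qed.

Lemma measurable_coord_affine n (M : 'M[R]_n) (b : 'cV_n) i :
  measurable_fun setT
    (fun t : n.-tuple RT => (M *m col_of_tuple t + b) i 0).
Proof.
rewrite (_ : (fun _ => _) =
    (fun t => \sum_j M i j * (col_of_tuple t) j 0) \+ cst (b i 0)).
  apply: measurable_funD => //; apply: measurable_sum => j.
  by apply: measurable_funM => //; exact: measurable_coord.
by apply/funext => t; rewrite !mxE.
Qed.

Lemma measurable_cV_affine n (M : 'M[R]_n) (b : 'cV_n) (X : set 'cV_n) :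
  measurable_cV X -> measurable_cV [set y | X (M *m y + b)].
Proof.
move=> mX; pose f (t : n.-tuple RT) : n.-tuple RT :=
  [tuple (M *m col_of_tuple t + b) i 0 | i < n].
have mf : measurable_fun setT f.
  apply/measurable_fun_tnthP => i.
  rewrite (_ : _ \o _ = fun t => (M *m col_of_tuple t + b) i 0).
    exact: measurable_coord_affine.
  by apply/funext => t /=; rewrite tnth_mktuple.
have := mf measurableT _ mX; rewrite setTI; congr measurable.
apply/seteqP; split => t /=; congr X; apply/colP => i;
by rewrite !mxE tnth_mktuple !mxE.
Qed.

Lemma measurable_affine (a b : R) (A : set RT) : measurable A ->
  measurable [set x : RT | A (a * x + b)].
Proof.
move=> mA; have mf : measurable_fun setT (fun x : RT => a * x + b : RT).
  by apply: measurable_funD => //; apply: measurable_funM.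
by have := mf measurableT _ mA; rewrite setTI.
Qed.

(** [a] times the image of Lebesgue measure under the affine map agrees with Lebesgue measure on
    half-open intervals, hence everywhere by uniqueness. *)
Lemma lebesgue_measure_affine_gt0 (a b : R) (A : set RT) :
  0 < a -> measurable A ->
  lebesgue_measure [set x : RT | A (a * x + b)] =
  (a^-1%:E * lebesgue_measure A)%E.
Proof.
move=> a0 mA.
have mf : measurable_fun setT (fun x : RT => a * x + b : RT).
  by apply: measurable_funD => //; apply: measurable_funM.
suff E : lebesgue_measure A =
    mscale (NngNum (ltW a0))
      (pushforward lebesgue_measure (fun x : RT => a * x + b : RT)) A.
  by rewrite (E mf) /mscale/= muleA -EFinM mulVf ?gt_eqF// mul1e.
move=> m; apply: lebesgue_measure_unique => // _ [[u v] _ <-]/=.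
rewrite /mscale /= /pushforward.
rewrite (_ : _ @^-1` _ = `](u - b) / a, (v - b) / a]%classic).
  rewrite !lebesgue_measure_itv/= !lte_fin ltr_pM2r ?invr_gt0// ltrD2r.
  case: ifP => _; last by rewrite mule0.
  rewrite -EFinM -!mulrBl; congr EFin.
  by rewrite opprB addrA subrK mulrC divfK ?gt_eqF.
apply/seteqP; split => x /=; rewrite !in_itv/=;
by rewrite ltr_pdivrMr// ler_pdivlMr// ltrBlDr lerBrDr [x * a]mulrC.
Qed.

Lemma lebesgue_measure_affine (a b : R) (A : set RT) :
  a != 0 -> measurable A ->
  lebesgue_measure [set x : RT | A (a * x + b)] =
  (`|a|^-1%:E * lebesgue_measure A)%E.
Proof.
move=> a_neq0 mA.
have [a0|a0|/eqP] := ltgtP a 0; last by rewrite (negbTE a_neq0).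
  (* A negative slope reduces to a positive one by reflection invariance. *)
  rewrite ltr0_norm// -lebesgue_measureN; last exact: measurable_affine.
  rewrite -(@lebesgue_measure_affine_gt0 (- a) b) ?oppr_gt0//.
  congr lebesgue_measure.
  by apply/seteqP; split => x /=; rewrite mulrN mulNr.
by rewrite gtr0_norm// lebesgue_measure_affine_gt0.
Qed.

Lemma col_of_tcons n (x : RT) (t : n.-tuple RT) :
  col_of_tuple (tcons (x, t)) = col_mx x%:M (col_of_tuple t).
Proof.
apply/colP => i; rewrite !mxE (tnth_nth 0)/=.
case: splitP => j ij; rewrite !mxE ij.
  by rewrite !ord1/= mulr1n.
by rewrite (tnth_nth 0).
Qed.

Lemma volume_xsection n (X : set 'cV[R]_n.+1) :
  volume X =
  (\int[lebesgue_measure]_x volume [set y : 'cV_n | X (col_mx x%:M y)])%E.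
Proof.
rewrite /volume /= /lebesgue_cons /pushforward /product_measure1.
apply: eq_integral => x _ /=; congr (lebesgue_tuple R n _).
by apply/seteqP; split => t;
  rewrite xsectionE/= -/(col_of_tuple t) -col_of_tcons.
Qed.

(** Tonelli: integrating in the other order also gives a product measure, and product measures are
    unique. *)
Lemma volume_ysection n (X : set 'cV[R]_n.+1) : measurable_cV X ->
  volume X =
  (\int[lebesgue_tuple R n]_t
     lebesgue_measure [set x : RT | X (col_mx x%:M (col_of_tuple t))])%E.
Proof.
move=> mX; transitivity ((lebesgue_measure \x^ lebesgue_tuple R n)%E
    (@tcons R n @^-1` [set t | X (col_of_tuple t)])).
  apply: product_measure_unique.
    by move=> A B mA mB; rewrite /= product_measure2E.
  by have := measurable_tcons measurableT mX; rewrite setTI.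
rewrite /product_measure2; apply: eq_integral => t _ /=.
congr lebesgue_measure.
by apply/seteqP; split => x; rewrite ysectionE/= -col_of_tcons.
Qed.

Lemma measurable_cV_xsection n (X : set 'cV[R]_n.+1) x : measurable_cV X ->
  measurable_cV [set y : 'cV_n | X (col_mx x%:M y)].
Proof.
move=> mX; have := measurable_tcons measurableT mX; rewrite setTI.
move=> /(measurable_xsection x); congr measurable.
by apply/seteqP; split => t; rewrite xsectionE/= -col_of_tcons.
Qed.

Lemma measurable_cV_ysection n (X : set 'cV[R]_n.+1) (t : n.-tuple RT) :
  measurable_cV X ->
  measurable [set x : RT | X (col_mx x%:M (col_of_tuple t))].
Proof.
move=> mX; have := measurable_tcons measurableT mX; rewrite setTI.
move=> /(measurable_ysection t); congr measurable.
by apply/seteqP; split => x; rewrite ysectionE/= -col_of_tcons.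
Qed.

Lemma measurable_volume_xsection n (X : set 'cV[R]_n.+1) : measurable_cV X ->
  measurable_fun setT
   (fun x : RT => volume [set y : 'cV_n | X (col_mx x%:M y)]).
Proof.
move=> mX; have := measurable_tcons measurableT mX; rewrite setTI.
move=> /(measurable_fun_xsection (lebesgue_tuple R n)); congr measurable_fun.
apply/funext => x /=; congr (lebesgue_tuple R n _).
by apply/seteqP; split => t;
  rewrite xsectionE/= -/(col_of_tuple t) -col_of_tcons.
Qed.

Lemma measurable_lebesgue_ysection n (X : set 'cV[R]_n.+1) : measurable_cV X ->
  measurable_fun setT
   (fun t : n.-tuple RT =>
     lebesgue_measure [set x : RT | X (col_mx x%:M (col_of_tuple t))]).
Proof.
move=> mX; have := measurable_tcons measurableT mX; rewrite setTI.
move=> /(measurable_fun_ysection lebesgue_measure); congr measurable_fun.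
apply/funext => x /=; congr lebesgue_measure.
by apply/seteqP; split => t; rewrite ysectionE/= -col_of_tcons.
Qed.

End measure_columns.

(** * Linear change of variables *)

Section linear_change_of_variables.
Context {R : realType}.
Local Notation RT := (measurableTypeR R).
Implicit Types n : nat.

(** Phrased with preimages, the property composes without inverting [M]. *)
Definition scales_volume n (M : 'M[R]_n) (b : 'cV[R]_n) :=
  forall X, measurable_cV X ->
  volume [set y | X (M *m y + b)] = (`|\det M|^-1%:E * volume X)%E.

Lemma scales_volumeM n (M1 M2 : 'M[R]_n) b1 b2 :
  scales_volume M1 b1 -> scales_volume M2 b2 ->
  scales_volume (M1 *m M2) (M1 *m b2 + b1).
Proof.
move=> s1 s2 X mX; rewrite det_mulmx normrM invfM [_^-1 * _]mulrC EFinM -muleA.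
rewrite -s1// -s2; last exact: measurable_cV_affine.
congr volume; apply/seteqP; split => y /=;
by rewrite mulmxDr addrA mulmxA.
Qed.

(** Such a map moves only the first coordinate: on each line parallel to that axis it is a
    one-dimensional affine map of slope [a]. *)
Lemma scales_volume_upper n (a : R) (r : 'rV[R]_n) (b : R) : a != 0 ->
  @scales_volume n.+1 (@block_mx _ 1 n 1 n a%:M r 0 1%:M)
    (@col_mx _ 1 n 1 b%:M 0).
Proof.
move=> a0 X mX; have mY := @measurable_cV_affine _ n.+1
  (@block_mx _ 1 n 1 n a%:M r 0 1%:M) (@col_mx _ 1 n 1 b%:M 0) _ mX.
rewrite volume_ysection// [in RHS]volume_ysection//.
rewrite (@det_ublock _ 1 n) det1 mulr1 det_scalar1.
rewrite -ge0_integralZl//; last exact: measurable_lebesgue_ysection.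
apply: eq_integral => t _.
rewrite -(lebesgue_measure_affine ((r *m col_of_tuple t) 0 0 + b))//;
  last first.
  exact: measurable_cV_ysection.
have E (x : R) : a%:M *m x%:M + r *m col_of_tuple t + b%:M =
    (a * x + ((r *m col_of_tuple t) 0 0 + b))%:M :> 'M[R]_(1, 1).
  apply/matrixP => i j; rewrite mul_scalar_mx !ord1 !mxE eqxx !mulr1n.
  by rewrite addrA.
congr lebesgue_measure; apply/seteqP; split => x /=;
  rewrite (@mul_block_col _ 1 n 1 n 1) (@add_col_mx _ 1 n 1) mul0mx mul1mx;
  by rewrite add0r addr0 E.
Qed.

(** The first coordinate [x] is kept, and the slice over it is mapped by [B] with a translation
    [c x + b] that depends on [x]; hence the hypothesis for every [b']. *)
Lemma scales_volume_lower n (c : 'cV[R]_n) (B : 'M[R]_n) (b : 'cV[R]_n) :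
  (forall b', scales_volume B b') ->
  @scales_volume n.+1 (@block_mx _ 1 n 1 n 1%:M 0 c B) (@col_mx _ 1 n 1 0 b).
Proof.
move=> sB X mX.
rewrite volume_xsection// [in RHS]volume_xsection//.
rewrite (@det_lblock _ 1 n) det1 mul1r.
rewrite -ge0_integralZl//; last exact: measurable_volume_xsection.
apply: eq_integral => x _.
rewrite -(sB (c *m x%:M + b)); last exact: measurable_cV_xsection.
congr volume; apply/seteqP; split => y /=;
  rewrite (@mul_block_col _ 1 n 1 n 1) (@add_col_mx _ 1 n 1) mul0mx mul1mx;
  by rewrite !addr0 addrA [B *m y + _]addrC.
Qed.

(* If the upper left entry of [M] is nonzero, [M] factors into a block lower and
   a block upper triangular matrix to which the two previous lemmas apply; a
   shear makes that entry nonzero. *)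
Lemma scales_volume_unitmx n (M : 'M[R]_n) (b : 'cV[R]_n) :
  M \in unitmx -> scales_volume M b.
Proof.
elim: n => [|n IH] in M b *.
  move=> _ X mX; rewrite det_mx00 normr1 invr1 mul1e; congr volume.
  by apply/seteqP; split => y /=; rewrite [M *m y + b]flatmx0 [y]flatmx0.
(* A translation is a shift of the first coordinate composed with a shift of the others. *)
have s1 b' : @scales_volume n.+1 1%:M b'.
  have -> : b' = 1%:M *m (@col_mx _ 1 n 1 0 (dsubmx (b' : 'cV_(1 + n)))) +
      @col_mx _ 1 n 1 (usubmx (b' : 'cV_(1 + n)) 0 0)%:M 0.
    by rewrite mul1mx -mx11_scalar (@add_col_mx _ 1 n) add0r addr0 vsubmxK.
  rewrite -[Z in scales_volume Z _]mulmx1; apply: scales_volumeM.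
    rewrite (@scalar_mx_block _ 1 n); apply: scales_volume_upper.
    exact: oner_neq0.
  rewrite (@scalar_mx_block _ 1 n); apply: scales_volume_lower => b''.
  by apply: IH; exact: unitmx1.
have s0 (M' : 'M[R]_n.+1) : M' \in unitmx ->
    ulsubmx (M' : 'M[R]_(1 + n)) 0 0 != 0 -> scales_volume M' 0.
  move=> + a0; rewrite unitmxE unitfE -[M'](@submxK _ 1 n 1 n).
  rewrite [ulsubmx _]mx11_scalar.
  move: (ulsubmx _ 0 0) a0 (ursubmx _) (dlsubmx _) (drsubmx _) => a a0 r c B.
  have -> : block_mx a%:M r c B =
      block_mx 1%:M 0 (a^-1 *: c) (B - a^-1 *: c *m r)
      *m block_mx a%:M r 0 1%:M.
    rewrite mulmx_block !mul1mx !mul0mx !mulmx0 !mulmx1 !addr0 subrKC.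
    by rewrite mul_mx_scalar scalerA mulfV// scale1r.
  rewrite det_mulmx (@det_ublock _ 1 n) (@det_lblock _ 1 n) !det1 mul1r.
  rewrite mulf_eq0 negb_or => /andP[uB _].
  rewrite [Y in scales_volume _ Y](_ : 0 =
    block_mx 1%:M 0 (a^-1 *: c) (B - a^-1 *: c *m r) *m 0 + 0); last first.
    by rewrite mulmx0 addr0.
  apply: scales_volumeM.
    rewrite -[Y in scales_volume _ Y](@col_mx0 _ 1 n 1).
    apply: scales_volume_lower => b'; apply: IH.
    by rewrite unitmxE unitfE.
  have := @scales_volume_upper n a r 0 a0.
  by rewrite raddf0 col_mx0.
suff sM : M \in unitmx -> scales_volume M 0.
  move=> /sM {}sM; rewrite -[M]mul1mx (_ : b = 1%:M *m 0 + b).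
    exact: scales_volumeM.
  by rewrite mulmx0 add0r.
move=> uM; have [a0|] := eqVneq (ulsubmx (M : 'M[R]_(1 + n)) 0 0) 0;
  last exact: s0.
have [k ck] : exists k, dlsubmx (M : 'M[R]_(1 + n)) k 0 != 0.
  apply/existsP; apply: contraLR uM; rewrite negb_exists => /forallP c0.
  rewrite unitmxE unitfE negbK -[M](@submxK _ 1 n 1 n).
  rewrite (_ : dlsubmx _ = 0); last first.
    apply/colP => k; rewrite [RHS]mxE; apply/eqP.
    by have := c0 k; rewrite negbK.
  by rewrite (@det_ublock _ 1 n) [ulsubmx _]mx11_scalar a0 raddf0 det0 mul0r.
(* Left multiplication by [E e] adds row [k] of the lower block to the first row, so that the zero
   corner becomes the nonzero [dlsubmx M k 0]. *)
pose e : 'rV[R]_n := delta_mx 0 k.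
pose E (u : 'rV[R]_n) : 'M[R]_(1 + n) := block_mx 1%:M u 0 1%:M.
have EK : E (- e) *m E e = 1%:M.
  rewrite mulmx_block !mul1mx !mul0mx !mulmx0 !mulmx1 !addr0 subrr add0r.
  by rewrite -scalar_mx_block.
rewrite -[M]mul1mx -EK -mulmxA.
rewrite [Y in scales_volume _ Y](_ : 0 = E (- e) *m 0 + 0); last first.
  by rewrite mulmx0 addr0.
apply: scales_volumeM.
  have := @scales_volume_upper n 1 (- e) 0 (oner_neq0 _).
  by rewrite raddf0 col_mx0.
apply: s0.
  by rewrite unitmx_mul uM andbT; have /mulmx1_unit[] := EK.
rewrite -[M](@submxK _ 1 n 1 n) (@mulmx_block _ 1 n 1 n 1 n).
rewrite block_mxKul !mul1mx mxE a0 add0r.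
move: ck; rewrite !mxE => ck.
rewrite (bigD1 k)//= big1 ?mxE ?eqxx ?mul1r ?addr0 ?mxE//.
by move=> j jk; rewrite mxE (negbTE jk) mul0r.
Qed.

End linear_change_of_variables.

(** * Volume of a simplex *)

Section simplex_volume.
Import numFieldNormedType.Exports.
Context {R : realType}.
Local Notation RT := (measurableTypeR R).
Local Notation mu := (@lebesgue_measure R).
Implicit Types n : nat.

Lemma integral_deriv_poly (p : {poly R}) (a b : R) : a < b ->
  (\int[mu]_(x in `[a, b]) (p^`().[x])%:E = (p.[b] - p.[a])%:E)%E.
Proof.
move=> ab; rewrite (@continuous_FTC2 _ _ (horner p))//.
- by apply: continuous_subspaceT; exact: continuous_horner.
- split=> [x _||]; first exact: derivable_horner.
  + exact/cvg_at_right_filter/continuous_horner.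
  + exact/cvg_at_left_filter/continuous_horner.
- by move=> x _; rewrite derivE.
Qed.

Lemma integral_itv_subX n (r : R) : 0 < r ->
  (\int[mu]_(x in `[0%R, r]) ((r - x) ^+ n / n`!%:R)%:E =
   (r ^+ n.+1 / n.+1`!%:R)%:E)%E.
Proof.
(* [p] is the antiderivative of the integrand that vanishes at [r]. *)
move=> r0; pose p : {poly R} := - (n.+1`!%:R^-1 *: (r%:P - 'X) ^+ n.+1).
have p'E x : p^`().[x] = (r - x) ^+ n / n`!%:R.
  rewrite /p derivN derivZ deriv_exp derivB derivC derivX sub0r !hornerE.
  rewrite hornerMn !hornerE/= mulN1r mulNrn mulrN opprK -[_ *+ n.+1]mulr_natr.
  rewrite factS natrM invfM [n.+1%:R^-1 * _]mulrC mulrACA mulVf ?pnatr_eq0//.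
  by rewrite mulr1 mulrC.
under eq_integral do rewrite -p'E.
rewrite integral_deriv_poly// /p !hornerE subrr expr0n/= mulr0 oppr0.
by rewrite sub0r opprK addr0 mulrC.
Qed.

(** [b] selects the closed simplex ([true]) or the open one ([false]), so that both are treated at
    once. *)
Definition std_simplex (b : bool) n (r : R) : set 'cV[R]_n :=
  [set y | (forall i, 0 < y i 0 ?<= if b) /\ \sum_i y i 0 < r ?<= if b].

Lemma measurable_lteif d (T : measurableType d) (b : bool) (f g : T -> R) :
  measurable_fun setT f -> measurable_fun setT g ->
  measurable [set x | f x < g x ?<= if b].
Proof.
move=> mf mg; have mP (h : T -> bool) :
    measurable_fun setT h -> measurable [set x | h x].
  by move=> mh; have := mh measurableT [set true] I; rewrite setTI.
case: b => /=; apply: mP; first exact: measurable_fun_ler.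
exact: measurable_fun_ltr.
Qed.

Lemma measurable_cV_std_simplex b n r : measurable_cV (@std_simplex b n r).
Proof.
apply: (@measurableI _ _
  [set t : n.-tuple RT | forall i, 0 < (col_of_tuple t) i 0 ?<= if b]).
  rewrite [X in measurable X](_ : _ = \bigcap_(i in [set: 'I_n])
      [set t : n.-tuple RT | 0 < (col_of_tuple t) i 0 ?<= if b]).
    apply: fin_bigcap_measurable => // i _; apply: measurable_lteif => //.
    exact: measurable_coord.
  by apply/seteqP; split => [t tP i _|t tP i]; exact: tP.
apply: measurable_lteif => //; apply: measurable_sum => i.
exact: measurable_coord.
Qed.

Lemma std_simplex_xsection b n r (x : R) :
  [set y : 'cV_n | std_simplex b r (col_mx x%:M y : 'cV_n.+1)] =
  if 0 < x ?<= if b then std_simplex b (r - x) else set0.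
Proof.
have E (y : 'cV_n) : std_simplex b r (col_mx x%:M y : 'cV_n.+1) <->
    0 < x ?<= if b /\ std_simplex b (r - x) y.
  rewrite /std_simplex/= (@big_split_ord _ _ _ 1 n) big_ord1.
  rewrite (@col_mxEu _ 1 n 1) mxE eqxx mulr1n.
  under eq_bigr do rewrite (@col_mxEd _ 1 n 1).
  rewrite lteifBrDl; split=> [[H ?]|[Hx [H ?]]].
    split.
      have := H (@lshift 1 n ord0).
      by rewrite (@col_mxEu _ 1 n 1) mxE eqxx mulr1n.
    split=> // i; by have := H (@rshift 1 n i); rewrite (@col_mxEd _ 1 n 1).
  split=> // i; case: (@split_ordP 1 n i) => j ->.
    by rewrite (@col_mxEu _ 1 n 1) !ord1 mxE eqxx mulr1n.
  by rewrite (@col_mxEd _ 1 n 1).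
case: ifPn => x0; apply/seteqP; split=> y //=.
- by move/E => [].
- by move=> ?; apply/E.
- by move/E => [x0']; rewrite x0' in x0.
Qed.

(** Induction on the dimension: the slice at [x] is the simplex of size [r - x], and its volume is
    integrated over [x]. *)
Lemma volume_std_simplex b n (r : R) : 0 < r ->
  volume (@std_simplex b n r) = (r ^+ n / n`!%:R)%:E.
Proof.
elim: n r => [|n IH] r r0.
  rewrite /volume/= (_ : mkset _ = setT) ?diracT ?expr0 ?fact0 ?divr1//.
  apply/seteqP; split=> // t _; split=> [[]//|].
  by rewrite big_ord0; exact: lteifS.
pose f (x : RT) :=
  volume [set y : 'cV_n | std_simplex b r (col_mx x%:M y : 'cV_n.+1)].
have mf : measurable_fun setT f.
  exact: measurable_volume_xsection (@measurable_cV_std_simplex b n.+1 r).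
(* At the endpoints the slice may depend on [b]; they form a null set, so both integrals are
   compared on the open interval. *)
have fE x : x \in `]0, r[ -> f x = ((r - x) ^+ n / n`!%:R)%:E.
  rewrite in_itv/= => /andP[x0 xr].
  by rewrite /f std_simplex_xsection lteifS// IH// subr_gt0.
have f0 x : x \notin `[0, r] -> f x = 0%E.
  rewrite in_itv/= negb_and -!ltNge => x0r.
  rewrite /f std_simplex_xsection; case: ifPn => x0; last exact: measure0.
  rewrite /volume [X in lebesgue_tuple R n X](_ : _ = set0) ?measure0//.
  rewrite -subset0 => t [t0 /lteifW]; apply/negP; rewrite -ltNge.
  have xr : r < x by case/orP: x0r => //; rewrite ltNge (lteifW x0).
  apply: (@lt_le_trans _ _ 0); first by rewrite subr_lt0.
  by apply: sumr_ge0 => i _; exact/lteifW/t0.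
rewrite volume_xsection -/f.
transitivity (\int[mu]_(x in `[0%R, r]) f x)%E.
  rewrite [RHS]integral_mkcond; apply: eq_integral => x _.
  rewrite patchE; case: ifPn => //; rewrite notin_setE => xr.
  by rewrite -/(f x) f0//; apply/negP.
have mg : measurable_fun setT (fun x : RT => ((r - x) ^+ n / n`!%:R)%:E).
  apply/measurable_EFinP; apply: measurable_funM => //.
  by apply: measurable_funX; apply: measurable_funB.
rewrite integral_itv_bndoo; last exact: measurable_funS mf.
rewrite -integral_itv_subX// [RHS]integral_itv_bndoo;
  last exact: measurable_funS mg.
by apply: eq_integral => x; rewrite inE/= => /fE.
Qed.

End simplex_volume.

(** * Lifted points, affine relations and barycentric coordinates *)

Section affine_lift.
Context {K : comNzRingType} {d m : nat} (p : 'I_m -> 'cV[K]_d).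

(** Any number of points over any commutative ring is allowed, so that one matrix gives the integer
    minors, the real simplices and, through its kernel, the affine relations. *)
Definition lift_mx : 'M[K]_(d.+1, m) :=
  \matrix_(k, j) if unlift ord_max k is Some i then p j i 0 else 1.

Lemma lift_mx_lift i j : lift_mx (lift ord_max i) j = p j i 0.
Proof. by rewrite mxE liftK. Qed.

Lemma lift_mx_max j : lift_mx ord_max j = 1.
Proof. by rewrite mxE unlift_none. Qed.

Lemma lift_mx_kernel (x : 'cV[K]_m) :
  lift_mx *m x = 0 <->
  \sum_j x j 0 = 0 /\ \sum_j x j 0 *: p j = 0.
Proof.
split=> [/colP px|[x0 px]].
  split.
    have := px ord_max; rewrite !mxE => E; rewrite -[RHS]E.
    by apply: eq_bigr => j _; rewrite lift_mx_max mul1r.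
  apply/colP => i; have := px (lift ord_max i); rewrite !mxE => E.
  rewrite -[RHS]E summxE; apply: eq_bigr => j _.
  by rewrite lift_mx_lift mxE mulrC.
apply/colP => k; rewrite !mxE; case: (unliftP ord_max k) => [i ->|->].
  transitivity ((\sum_j x j 0 *: p j) i 0); last by rewrite px mxE.
  by rewrite summxE; apply: eq_bigr => j _; rewrite lift_mx_lift mxE mulrC.
by rewrite -[RHS]x0; apply: eq_bigr => j _; rewrite lift_mx_max mul1r.
Qed.

End affine_lift.

(** Right multiplication by the unitriangular [E] subtracts the last column from the others. The row
    of ones becomes [(0, ..., 0, 1)], and the determinant is expanded along it. *)
Lemma det_lift_mx (K : comNzRingType) d (q : 'I_d.+1 -> 'cV[K]_d) :
  \det (lift_mx q) =
  \det (\matrix_(i, j) (q (lift ord_max j) i 0 - q ord_max i 0)).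
Proof.
pose E : 'M[K]_d.+1 :=
  \matrix_(i, j) ((i == j)%:R - ((i == ord_max) && (j != ord_max))%:R).
have EE i j : E i j = (i == j)%:R - ((i == ord_max) && (j != ord_max))%:R.
  by rewrite mxE.
have detE : \det E = 1.
  rewrite det_trig; last first.
    apply/is_trig_mxP => i j ij; rewrite mxE -val_eqE (ltn_eqF ij) sub0r.
    by rewrite -val_eqE (ltn_eqF (leq_trans ij _)) ?oppr0// -ltnS.
  by rewrite big1// => i _; rewrite mxE eqxx andbN subr0.
rewrite -[LHS]mulr1 -detE -det_mulmx.
have QE k j : (lift_mx q *m E) k j =
    lift_mx q k j - (if j != ord_max then lift_mx q k ord_max else 0).
  rewrite mxE; under eq_bigr do rewrite EE mulrBr.
  rewrite sumrB (bigD1 j)//= eqxx mulr1 big1 ?addr0; last first.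
    by move=> i /negbTE ->; rewrite mulr0.
  congr (_ - _); rewrite (bigD1 ord_max)//= eqxx big1 ?addr0; last first.
    by move=> i /negbTE ->; rewrite mulr0.
  by case: ifP => _; rewrite ?mulr1 ?mulr0.
rewrite (expand_det_row _ ord_max) (bigD1 ord_max)//= big1 ?addr0; last first.
  by move=> j jmax; rewrite QE jmax !lift_mx_max subrr mul0r.
rewrite QE eqxx subr0 lift_mx_max mul1r /cofactor addnn -signr_odd odd_double.
rewrite expr0 mul1r; congr (\det _); apply/matrixP => i j.
by rewrite mxE mxE QE eq_sym neq_lift !lift_mx_lift mxE.
Qed.

Section simplices.
Context {R : realType}.
Local Notation RT := (measurableTypeR R).

Definition simplex (b : bool) d (q : 'I_d.+1 -> 'cV[R]_d) : set 'cV[R]_d :=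
  [set y | exists l : 'I_d.+1 -> R, [/\ forall j, 0 < l j ?<= if b,
     \sum_j l j = 1 & y = \sum_j l j *: q j]].

(** The weights [l] other than the last are affine coordinates: [y - q ord_max = M *m l]. The last
    weight is [1] minus their sum, so its sign condition becomes the bound on the sum. *)
Lemma simplex_affine b d (q : 'I_d.+1 -> 'cV[R]_d) :
  \det (lift_mx q) != 0 ->
  let M := \matrix_(i, j) (q (lift ord_max j) i 0 - q ord_max i 0) in
  simplex b q =
  [set y | std_simplex b 1 (invmx M *m y + - (invmx M *m q ord_max))].
Proof.
move=> q0 M; have uM : M \in unitmx by rewrite unitmxE unitfE -det_lift_mx.
have ME (l : 'cV[R]_d) : M *m l =
    \sum_j l j 0 *: q (lift ord_max j) - (\sum_j l j 0) *: q ord_max.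
  apply/colP => i; rewrite !mxE summxE mulr_suml -sumrB; apply: eq_bigr => j _.
  by rewrite !mxE mulrBl mulrC [q ord_max i 0 * _]mulrC.
apply/seteqP; split => y /=.
  move=> [l [l0 l1 ->]]; pose l' : 'cV[R]_d := \col_j l (lift ord_max j).
  have l'E j : l' j 0 = l (lift ord_max j) by rewrite mxE.
  have lmax : l ord_max = 1 - \sum_j l (lift ord_max j).
    by rewrite -l1 [in RHS](bigD1_ord ord_max)//= addrK.
  rewrite (bigD1_ord ord_max)//= lmax scalerBl scale1r -mulmxBr.
  rewrite [X in invmx M *m X](_ : _ = M *m l'); last first.
    rewrite ME addrAC [q ord_max - _]addrC addrK addrC.
    by under [in RHS]eq_bigr do rewrite l'E;
       under [in X in _ = _ - X *: _]eq_bigr do rewrite l'E.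
  rewrite mulKmx//; split=> [i|]; first by rewrite l'E.
  under eq_bigr do rewrite l'E.
  by have := l0 ord_max; rewrite lmax lteifBrDr add0r.
rewrite -mulmxBr; set l := invmx M *m _ => -[l0 l1].
pose f j := if unlift ord_max j is Some i then l i 0 else 1 - \sum_i l i 0.
have fmax : f ord_max = 1 - \sum_i l i 0 by rewrite /f unlift_none.
have flift i : f (lift ord_max i) = l i 0 by rewrite /f liftK.
exists f; split.
- move=> j; case: (unliftP ord_max j) => [i ->|->]; first by rewrite flift.
  by rewrite fmax lteifBrDr add0r.
- rewrite (bigD1_ord ord_max)//= fmax.
  by under eq_bigr do rewrite flift; rewrite subrK.
- rewrite (bigD1_ord ord_max)//= fmax.
  under eq_bigr do rewrite flift.
  have := ME l; rewrite /l mulKVmx// -/l scalerBl scale1r => /eqP.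
  rewrite subr_eq => /eqP ->; rewrite addrAC [RHS]addrAC; congr (_ - _).
  exact: addrC.
Qed.

Lemma measurable_cV_simplex b d (q : 'I_d.+1 -> 'cV[R]_d) :
  \det (lift_mx q) != 0 -> measurable_cV (simplex b q).
Proof.
move=> /simplex_affine ->; apply: measurable_cV_affine.
exact: measurable_cV_std_simplex.
Qed.

Lemma volume_simplex b d (q : 'I_d.+1 -> 'cV[R]_d) :
  \det (lift_mx q) != 0 ->
  volume (simplex b q) = (`|\det (lift_mx q)| / d`!%:R)%:E.
Proof.
move=> q0; rewrite simplex_affine//.
rewrite scales_volume_unitmx; last exact: measurable_cV_std_simplex.
  rewrite volume_std_simplex// expr1n det_inv normfV invrK -EFinM mul1r.
  by rewrite det_lift_mx.
by rewrite unitmx_inv unitmxE unitfE -det_lift_mx.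
Qed.

End simplices.

(** * Convex hull of a circuit *)

Lemma conv_lmodE (R : numDomainType) (E : lmodType R) (t : {i01 R})
    (x y : convex_lmodType E) :
  conv t x y = t%:num *: (x : E) + (1 - t%:num) *: (y : E).
Proof. by []. Qed.

(** Induction on [n]: the first point is split off and the other weights are renormalised by their
    sum [S]; if [S = 0], only the first point remains. *)
Lemma convex_set_sum (R : realType) (E : lmodType R) (C : set E) :
  @convex_set R E C -> forall n (q : 'I_n -> E) (l : 'I_n -> R),
  (forall i, C (q i)) -> (forall i, 0 <= l i) -> \sum_i l i = 1 ->
  C (\sum_i l i *: q i).
Proof.
move=> cC; elim=> [|n IH] q l Cq l0 l1.
  by move: l1; rewrite big_ord0 => /esym/eqP; rewrite oner_eq0.
rewrite big_ord_recl; have := l1; rewrite big_ord_recl => l1'.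
set S := \sum_(i < n) l (lift ord0 i) in l1'.
have S0 : 0 <= S by apply: sumr_ge0 => i _; exact: l0.
have [S_eq0|S_neq0] := eqVneq S 0.
  move: l1'; rewrite S_eq0 addr0 => ->; rewrite scale1r big1 ?addr0// => i _.
  have /eqP := S_eq0; rewrite psumr_eq0 => [/allP/(_ i)|j _]; last exact: l0.
  by rewrite mem_index_enum => /(_ isT)/eqP ->; rewrite scale0r.
have lle1 : l ord0 <= 1 by rewrite -l1' lerDl.
have CB : C (\sum_(i < n) (l (lift ord0 i) / S) *: q (lift ord0 i)).
  apply: IH => [i|i|]; [exact: Cq|by rewrite divr_ge0|].
  by rewrite -mulr_suml divff.
have := @cC _ _ (Itv01 (l0 ord0) lle1) (mem_set (Cq ord0)) (mem_set CB).
rewrite inE conv_lmodE/= (_ : 1 - l ord0 = S); last first.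
  by rewrite -l1' addrAC subrr add0r.
rewrite scaler_sumr; congr (C (_ + _)); apply: eq_bigr => i _.
by rewrite scalerA mulrC divfK.
Qed.

Lemma convex_hull_range (R : realType) d n (p : 'I_n -> 'cV[R]_d) :
  convex_hull (range p) =
  [set y | exists l : 'I_n -> R, [/\ forall i, 0 <= l i, \sum_i l i = 1
    & y = \sum_i l i *: p i]].
Proof.
rewrite /convex_hull.
apply/seteqP; split => [|_ [l [l0 l1 ->]] C [cC pC]]; last first.
  by apply: (convex_set_sum cC) => // i; apply: pC; exists i.
apply: smallest_sub => [x y t|_ [i _ <-]].
  rewrite !inE => -[a [a0 a1 ->]] [b [b0 b1 ->]].
  exists (fun i => t%:num * a i + (1 - t%:num) * b i); split.
  - by move=> i; rewrite addr_ge0// mulr_ge0// subr_ge0.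
  - by rewrite big_split/= -!mulr_sumr a1 b1 !mulr1 subrKC.
  - rewrite conv_lmodE/= !scaler_sumr -big_split; apply: eq_bigr => i _ /=.
    by rewrite !scalerA scalerDl.
exists (fun j => (j == i)%:R); split => [j||]; first exact: ler0n.
  by rewrite (bigD1 i)//= eqxx big1 ?addr0// => j /negbTE ->.
rewrite (bigD1 i)//= eqxx scale1r big1 ?addr0// => j /negbTE ->.
by rewrite scale0r.
Qed.

Lemma measure_bigsetU_le dT (T : measurableType dT) (R : realType)
    (m : {measure set T -> \bar R}) I (s : seq I) (P : pred I)
    (F : I -> set T) :
  (forall i, measurable (F i)) ->
  (m (\big[setU/set0]_(i <- s | P i) F i) <= \sum_(i <- s | P i) m (F i))%E.
Proof.
move=> mF; elim: s => [|i s IH]; first by rewrite !big_nil measure0.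
rewrite !big_cons; case: ifP => // _.
by rewrite (le_trans (measureU2 _ _ _))// ?leeD2l//; exact: bigsetU_measurable.
Qed.

Section circuit.
Context {R : realType} {d : nat} (p : 'I_d.+2 -> 'cV[R]_d) (w : 'I_d.+2 -> R).
Hypothesis w_sum0 : \sum_i w i = 0.
Hypothesis w_rel : \sum_i w i *: p i = 0.
Hypothesis w_span : forall x : 'I_d.+2 -> R, \sum_i x i = 0 ->
  \sum_i x i *: p i = 0 -> exists s, forall i, x i = s * w i.
Hypothesis w_pos : exists i, 0 < w i.
Hypothesis p_indep : forall i, \det (lift_mx (p \o lift i)) != 0.

(** Weights indexed by all vertices, with a zero at the omitted one, let different simplices be
    compared through [w]. *)
Lemma simplex_lift b i y :
  simplex b (p \o lift i) y <->
  exists l : 'I_d.+2 -> R, [/\ l i = 0, forall j, j != i -> 0 < l j ?<= if b,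
    \sum_j l j = 1 & y = \sum_j l j *: p j].
Proof.
split=> [[l [l0 l1 ->]]|[l [li l0 l1 ->]]].
  pose f j := if unlift i j is Some k then l k else 0.
  have fi : f i = 0 by rewrite /f unlift_none.
  have fl k : f (lift i k) = l k by rewrite /f liftK.
  exists f; split=> //.
  - by move=> j; case: (unliftP i j) => [k -> _|->]; rewrite ?fl// eqxx.
  - rewrite (bigD1_ord i)//= fi add0r -[RHS]l1.
    by apply: eq_bigr => k _; rewrite fl.
  - rewrite [RHS](bigD1_ord i)//= fi scale0r add0r.
    by apply: eq_bigr => k _; rewrite fl.
exists (l \o lift i); split.
- by move=> j; apply: l0; rewrite eq_sym neq_lift.
- by rewrite -[RHS]l1 [RHS](bigD1_ord i)//= li add0r.
- by rewrite (bigD1_ord i)//= li scale0r add0r.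
Qed.

(* Every point of the hull has a representation in which no positive multiple
   of [w] can be subtracted; it misses a vertex [i] with [0 < w i]. *)
Lemma convex_hull_circuit :
  convex_hull (range p) =
  \big[setU/set0]_(i | 0 < w i) simplex true (p \o lift i).
Proof.
rewrite convex_hull_range -bigcup_seq_cond; apply/seteqP; split => y /=.
  move=> [l [l0 l1 ->]]; have [i0 wi0] := w_pos.
  (* The minimum of [l i / w i] over [0 < w i] is the largest multiple that can be subtracted. *)
  case: (@arg_minP _ _ _ i0 (fun i => 0 < w i) (fun i => l i / w i) wi0).
  move=> i wi imin.
  exists i; first by rewrite /= mem_index_enum.
  apply/simplex_lift; exists (fun j => l j - l i / w i * w j); split.
  - by rewrite divfK ?subrr ?gt_eqF.
  - move=> j _ /=; rewrite subr_ge0; have [wj|wj] := ltP 0 (w j).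
      by rewrite -ler_pdivlMr//; exact: imin.
    by rewrite (le_trans _ (l0 j))// mulr_ge0_le0// divr_ge0// ltW.
  - by rewrite sumrB l1 -mulr_sumr w_sum0 mulr0 subr0.
  - under [RHS]eq_bigr do rewrite scalerBl -scalerA.
    by rewrite sumrB -scaler_sumr w_rel scaler0 subr0.
move=> [i _ /simplex_lift [l [li l0 l1 ->]]]; exists l; split=> // j.
by have [->|/l0//] := eqVneq j i; rewrite li.
Qed.

(** Two representations of [y] differ by a multiple [s] of [w]. For distinct [i] and [j], the zero
    of the first at [i] forces [s < 0], and the zero of the second at [j] forces [0 < s]. *)
Lemma simplex_circuit_disjoint i j y : 0 < w i -> 0 < w j ->
  simplex false (p \o lift i) y -> simplex false (p \o lift j) y -> i = j.
Proof.
move=> wi wj /simplex_lift[a [ai a0 a1 ->]] /simplex_lift[b [bj b0 b1 ab]].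
apply/eqP; apply: contraTT isT => ij.
have [s sP] : exists s, forall k, a k - b k = s * w k.
  apply: w_span; first by rewrite sumrB a1 b1 subrr.
  under eq_bigr do rewrite scalerBl.
  by rewrite sumrB ab subrr.
have := sP i; rewrite ai sub0r => /eqP; rewrite eqr_oppLR => /eqP bi.
have := b0 i ij; rewrite /= bi -mulNr pmulr_lgt0// oppr_gt0 => s0.
have := a0 j; rewrite eq_sym => /(_ ij)/=.
by have := sP j; rewrite bj subr0 => ->; rewrite pmulr_lgt0// ltNge (ltW s0).
Qed.

(** The closed simplices cover the hull, which bounds its volume above by subadditivity; the
    disjoint open ones lie inside it, which bounds it below by the same sum. *)
Lemma volume_circuit :
  volume (convex_hull (range p)) =
  (\sum_(i | (0 < w i)%R) (`|\det (lift_mx (p \o lift i))| / d`!%:R)%:E)%E.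
Proof.
pose F b i := [set t : d.-tuple (measurableTypeR R) |
  simplex b (p \o lift i) (col_of_tuple t)].
have mF b i : measurable (F b i) by exact: measurable_cV_simplex.
have volF b i : lebesgue_tuple R d (F b i) =
    (`|\det (lift_mx (p \o lift i))| / d`!%:R)%:E.
  exact: volume_simplex.
have hullE : [set t | convex_hull (range p) (col_of_tuple t)] =
    \big[setU/set0]_(i | 0 < w i) F true i.
  rewrite convex_hull_circuit -!bigcup_seq_cond.
  by apply/seteqP; split => t /= [i ? ?]; exists i.
have volsum b : (\sum_(i | (0 < w i)%R)
    (`|\det (lift_mx (p \o lift i))| / d`!%:R)%:E =
    \sum_(i | (0 < w i)%R) lebesgue_tuple R d (F b i))%E.
  by apply: eq_bigr => i _; rewrite volF.
transitivity (lebesgue_tuple R d (\big[setU/set0]_(i | 0 < w i) F true i)).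
  by rewrite -hullE.
apply/eqP; rewrite eq_le; apply/andP; split.
  by rewrite (volsum true) measure_bigsetU_le.
rewrite (volsum false) -measure_bigsetU_ord_cond//.
  apply: le_measure; rewrite ?inE; [exact: bigsetU_measurable..|].
  rewrite -!bigcup_seq_cond => t [i wi [l [l0 l1 tE]]]; exists i => //.
  by exists l; split=> // j; exact/ltW/l0.
apply/trivIsetP => i j wi wj ij; rewrite -subset0 => t [ti tj].
by move/eqP: ij; apply; exact: simplex_circuit_disjoint wi wj ti tj.
Qed.

End circuit.

(** * Signed minors and compositions *)

Section maximal_minors.
Context {K : idomainType} {n : nat} (V : 'M[K]_(n, n.+1)).

(** The generalised cross product of the rows of [V]. *)
Definition signed_minors : 'cV[K]_n.+1 := \col_i ((-1) ^+ i * \det (col' i V)).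

(** Entry [k] is the Laplace expansion, along the first row, of the determinant of [V] with its row
    [k] repeated on top; two rows are equal. *)
Lemma mulmx_signed_minors : V *m signed_minors = 0.
Proof.
apply/colP => k; rewrite !mxE.
pose W : 'M[K]_n.+1 := @col_mx _ 1 n n.+1 (row k V) V.
transitivity (\det W).
  rewrite (expand_det_row W ord0); apply: eq_bigr => j _.
  rewrite mxE (_ : W ord0 j = V k j); last first.
    rewrite /W (_ : @ord0 n = @lshift 1 n ord0); last exact: val_inj.
    by rewrite (@col_mxEu _ 1 n n.+1) mxE.
  rewrite /cofactor add0n; congr (_ * (_ * \det _)).
  apply/matrixP => a b; rewrite !mxE.
  rewrite (_ : lift (@ord0 n) a = @rshift 1 n a); last exact: val_inj.
  by rewrite (unsplitK (inr a)).
apply: (@determinant_alternate _ _ W (@lshift 1 n ord0) (@rshift 1 n k)).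
  by rewrite -val_eqE.
by move=> j; rewrite /W (@col_mxEu _ 1 n n.+1) (@col_mxEd _ 1 n n.+1) mxE.
Qed.

Lemma col'_mul (i : 'I_n.+1) (x : 'cV[K]_n.+1) :
  x i 0 = 0 -> V *m x = col' i V *m row' i x.
Proof.
move=> xi0; apply/colP => k; rewrite !mxE (bigD1_ord i)//= xi0 mulr0 add0r.
by apply: eq_bigr => j _; rewrite !mxE.
Qed.

(* The difference of the two sides is a kernel vector with a zero at [i]; it
   vanishes because the columns of [V] other than the [i]-th are independent. *)
Lemma kernel_signed_minors (i : 'I_n.+1) (x : 'cV[K]_n.+1) :
  \det (col' i V) != 0 -> V *m x = 0 ->
  signed_minors i 0 *: x = x i 0 *: signed_minors.
Proof.
move=> Di Vx; pose y := signed_minors i 0 *: x - x i 0 *: signed_minors.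
have yi : y i 0 = 0 by rewrite !mxE mulrC subrr.
have : V *m y = 0.
  by rewrite mulmxBr -!scalemxAr Vx mulmx_signed_minors !scaler0 subrr.
(* The adjugate replaces an inverse, as [K] is only an integral domain. *)
rewrite (col'_mul yi) => /(congr1 (mulmx (\adj (col' i V)))).
rewrite mulmxA mul_adj_mx mulmx0 mul_scalar_mx => /colP y0.
apply/eqP; rewrite -subr_eq0 -/y; apply/eqP/colP => j; rewrite [RHS]mxE.
case: (unliftP i j) => [j' ->|->//].
by have := y0 j'; rewrite !mxE => /eqP; rewrite mulf_eq0 (negbTE Di) => /eqP.
Qed.

End maximal_minors.

(** * Greatest common divisor of a finite family *)

Section big_gcd.
Variable (I : finType) (F : I -> int).
Let g : int := \big[gcdz/0]_i F i.

Lemma dvdz_biggcd i : (g %| F i)%Z.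
Proof.
rewrite /g; have := mem_index_enum i.
elim: (index_enum I) => // j s IH; rewrite big_cons inE => /predU1P[->|/IH].
  exact: dvdz_gcdl.
exact/dvdz_trans/dvdz_gcdr.
Qed.

Lemma biggcd_bezout : exists c : I -> int, \sum_i c i * F i = g.
Proof.
apply: (big_ind (fun x => exists c, \sum_i c i * F i = x)) => [|x y|i _].
- by exists (fun=> 0); rewrite big1// => i _; rewrite mul0r.
- move=> [a <-] [b <-].
  have [s [t <-]] := Bezoutz (\sum_i a i * F i) (\sum_i b i * F i).
  exists (fun i => s * a i + t * b i).
  rewrite !mulr_sumr -big_split; apply: eq_bigr => i _ /=.
  by rewrite mulrDl !mulrA.
- exists (fun j => (j == i)%:R); rewrite (bigD1 i)//= eqxx mul1r big1 ?addr0//.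
  by move=> j /negbTE ->; rewrite mul0r.
Qed.

Lemma biggcd_ge0 : 0 <= g.
Proof. exact: (big_rec (fun x => 0 <= x)). Qed.

End big_gcd.

(** * Counting compositions with lower bounds on the parts *)

Section counting.
Local Open Scope nat_scope.
Context {m : nat}.
Implicit Types h : nat.

(** Bounding the parts by [h] makes the type finite; this is the set counted by
    [card_ord_partitions]. *)
Definition compositions h : {set m.+1.-tuple 'I_h.+1} :=
  [set t : m.+1.-tuple 'I_h.+1 | \sum_(i <- t) i == h].

Lemma mem_compositions h t :
  (t \in compositions h) = (\sum_i tnth t i == h).
Proof. by rewrite inE big_tuple. Qed.

(** When the parts sum to [h], each is at most [h] and [inord] leaves it unchanged. *)
Definition composition h (f : 'I_m.+1 -> nat) : m.+1.-tuple 'I_h.+1 :=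
  [tuple inord (f i) | i < m.+1].

Lemma tnth_composition h (f : 'I_m.+1 -> nat) i : \sum_j f j = h ->
  tnth (composition h f) i = f i :> nat.
Proof.
move=> <-; rewrite tnth_mktuple inordK// ltnS (bigD1 i)//=.
exact: leq_addr.
Qed.

Lemma composition_in h (f : 'I_m.+1 -> nat) : \sum_j f j = h ->
  composition h f \in compositions h.
Proof.
move=> fh; rewrite mem_compositions; apply/eqP.
by rewrite -[RHS]fh; apply: eq_bigr => i _; rewrite tnth_composition.
Qed.

(** Adding [p] is a bijection from the compositions of [h - \sum_i p i] onto the set counted
    here. *)
Lemma card_compositions_ge h (p : 'I_m.+1 -> nat) :
  #|[set t in compositions h | [forall i, p i <= tnth t i]]| =
  if \sum_i p i <= h then 'C(m + (h - \sum_i p i), m) else 0.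
Proof.
case: ifPn => [ph|]; last first.
  rewrite -ltnNge => hp; apply/eqP; rewrite cards_eq0; apply/eqP/setP => t.
  rewrite finset.in_set0 inE mem_compositions.
  apply/negbTE/andP => -[/eqP th /forallP pt].
  move: hp; rewrite ltnNge -[X in _ <= X]th => /negP; apply.
  by apply: leq_sum => i _; exact: pt.
set k := h - _; rewrite -card_ord_partitions -/(compositions k).
pose f (t : m.+1.-tuple 'I_k.+1) := composition h (fun i => tnth t i + p i).
have fh t : t \in compositions k -> \sum_i (tnth t i + p i) = h.
  by rewrite mem_compositions big_split/= => /eqP ->; rewrite /k subnK.
rewrite -(card_in_imset (f := f)); last first.
  move=> t s tk sk fts; apply: eq_from_tnth => i; apply/val_inj => /=.
  apply: (@addIn (p i)).
  rewrite -(tnth_composition i (fh _ tk)) -(tnth_composition i (fh _ sk)).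
  by rewrite -/(f t) fts.
congr #|pred_of_set _|; apply/setP => t; rewrite inE; apply/andP/imsetP.
  rewrite mem_compositions => -[/eqP th /forallP pt].
  have tk : \sum_i (tnth t i - p i) = k.
    by rewrite sumnB ?th.
  exists (composition k (fun i => tnth t i - p i)); first exact: composition_in.
  apply: eq_from_tnth => i; apply/val_inj => /=.
  have E : \sum_i (tnth (composition k (fun i => tnth t i - p i)) i + p i) = h.
    by apply: fh; exact: composition_in.
  by rewrite (tnth_composition _ E) (tnth_composition _ tk) subnK.
move=> [s sk ->]; split; first by apply: composition_in; exact: fh.
by apply/forallP => i; rewrite (tnth_composition _ (fh _ sk)) leq_addl.
Qed.

End counting.

Lemma absz_max0_le (a : int) (n : nat) :
  (`|Num.max 0%R a| <= n)%N = (a <= n%:Z).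
Proof. by case: (leP 0%R a) => a0; lia. Qed.

(** If [0 < a], then [a <= k * a = p - q <= p]. Used coordinatewise: when [t - s] is a positive
    multiple of [w], one copy of [w] can be subtracted from [t]. *)
Lemma le_of_subz_mul (k a : int) (p q : nat) :
  0 < k -> p%:Z - q%:Z = k * a -> a <= p%:Z.
Proof. by case: (lerP a 0); nia. Qed.

(** * Sumsets as classes of compositions *)

Section sumset_count.
Context {m d : nat} (v : 'I_m.+1 -> 'cV[int]_d).
Implicit Types h : nat.

Definition weighted_sum h (t : m.+1.-tuple 'I_h.+1) : 'cV[int]_d :=
  \sum_i v i *+ tnth t i.

(** A sum of [h] points is determined by how often each [v j] occurs, and these multiplicities form
    a composition of [h]. *)
Lemma in_sumset h (A : {fset 'cV[int]_d}) (x : 'cV[int]_d) :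
  A = [fset v i | i in 'I_m.+1]%fset ->
  reflect (exists2 t, t \in compositions h & weighted_sum t = x)
    (x \in sumset h A).
Proof.
move=> AE; rewrite /sumset; apply: (iffP (imfsetP _ _ _ _)) => [[a _ ->]|[t]].
  have /fin_all_exists[g gE] : forall i, exists j, val (a i) = v j.
    move=> i; have := valP (a i); rewrite [X in _ \in X]AE => /imfsetP[j _ ->].
    by exists j.
  have ch : (\sum_j #|[pred i | g i == j]| = h)%N.
    rewrite -[RHS]card_ord -sum1_card (partition_big g xpredT)//=.
    by apply: eq_bigr => j _; rewrite sum1_card.
  exists (composition h (fun j => #|[pred i | g i == j]|)).
    exact: composition_in.
  rewrite /weighted_sum (partition_big g xpredT)//=.
  apply: eq_bigr => j _; rewrite (tnth_composition _ ch) -sumr_const.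
  by apply: eq_big => // i /eqP <-; rewrite gE.
rewrite mem_compositions => /eqP th <-.
(* [s] lists each index [j] exactly [tnth t j] times. *)
pose s := flatten [seq nseq (tnth t j) j | j <- enum 'I_m.+1].
have sE : size s = h.
  rewrite size_flatten /shape -map_comp sumnE big_map big_enum/= -[RHS]th.
  by apply: eq_bigr => j _; rewrite size_nseq.
have vA i : v i \in A by rewrite AE; apply/imfsetP; exists i.
exists [ffun i : 'I_h => [` vA (nth ord0 s i)]%fset] => //.
transitivity (\sum_(j <- s) v j).
  rewrite big_flatten/= big_map big_enum/=; apply: eq_bigr => j _.
  by rewrite big_nseq; elim: (nat_of_ord _) => //= k <-; rewrite mulrS.
rewrite (big_nth ord0) sE big_mkord; apply: eq_bigr => i _.
by rewrite ffunE.
Qed.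

(** [Y] consists of the compositions from which [w] can be subtracted. Outside [Y], [weighted_sum]
    is injective and still reaches the whole sumset. *)
Lemma card_sumset h (A : {fset 'cV[int]_d}) (w : 'I_m.+1 -> int) :
  A = [fset v i | i in 'I_m.+1]%fset ->
  (exists i, 0 < w i) -> \sum_i w i = 0 ->
  (forall x : 'I_m.+1 -> int, \sum_i x i = 0 ->
    \sum_i v i *~ x i = 0 <-> exists k, forall i, x i = k * w i) ->
  let N := (\sum_i `|Num.max 0%R (w i)|)%N in
  (#|` sumset h A| + (if (N <= h)%N then 'C(m + (h - N), m) else 0) =
   'C(m + h, m))%N.
Proof.
move=> AE [i0 wi0] w0 wP N.
pose p i := `|Num.max 0%R (w i)|%N.
rewrite -card_compositions_ge -card_ord_partitions -/(compositions h).
set X := compositions h; set Y := [set t in X | _].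
have wsB (t s : m.+1.-tuple 'I_h.+1) : t \in X -> s \in X ->
    weighted_sum t = weighted_sum s <->
    exists k, forall i, (tnth t i)%:Z - (tnth s i)%:Z = k * w i.
  rewrite !mem_compositions => /eqP th /eqP sh.
  rewrite -wP; last first.
    by rewrite sumrB -!(big_morph _ PoszD (erefl _)) th sh subrr.
  rewrite (eq_bigr (fun i => v i *+ tnth t i - v i *+ tnth s i)); last first.
    by move=> i _; rewrite mulrzBr -!pmulrn.
  rewrite sumrB -/(weighted_sum t) -/(weighted_sum s).
  by split=> [->|/eqP]; [rewrite subrr|rewrite subr_eq0 => /eqP].
(* The parts of [t] are nonnegative, so bounding them below by [w i] or by its positive part is the
   same. *)
have inY (t : m.+1.-tuple 'I_h.+1) :
    (t \in Y) = (t \in X) && [forall i, w i <= (tnth t i)%:Z].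
  rewrite inE; congr andb; apply: eq_forallb => i; exact: absz_max0_le.
rewrite -[RHS](cardsID Y) addnC; congr addn.
  by congr #|pred_of_set _|; apply/setP => t; rewrite !inE andbA andbb.
have inj : {in X :\: Y &, injective (@weighted_sum h)}.
  move=> t s /setDP[tX tY] /setDP[sX sY] /(wsB _ _ tX sX)[k kP].
  move: tY sY; rewrite !inY tX sX /= => /forallPn[i ti] /forallPn[j sj].
  (* If [t - s = k w] with [k] nonzero, then [w] can be subtracted from [t] or from [s]. *)
  have [k0|k0|k0] := ltgtP k 0.
  - case/negP: sj; apply: (@le_of_subz_mul (- k) _ _ (tnth t j)).
      by rewrite oppr_gt0.
    by rewrite mulNr -kP opprB.
  - by case/negP: ti; exact: le_of_subz_mul k0 (kP i).
  - apply: eq_from_tnth => l; apply/val_inj => /=.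
    by have := kP l; rewrite k0 mul0r; lia.
transitivity #|` seq_fset tt [seq weighted_sum t | t <- enum (X :\: Y)]|.
  congr #|` _|; apply/fsetP => x; rewrite seq_fsetE.
  apply/(in_sumset _ _ AE)/mapP => [[t tX <-]|[t]]; last first.
    by rewrite mem_enum => /setDP[tX _] ->; exists t.
  (* Descent on the part at [i0], where [w] is positive: subtracting [w] keeps the weighted sum and
     decreases this part until [Y] is left. *)
  have [n] := ubnP (tnth t i0); elim: n => // n IH in t tX *.
  rewrite ltnS => tn; have [tY|tY] := boolP (t \in Y); last first.
    by exists t => //; rewrite mem_enum; apply/setDP.
  move: (tY); rewrite inY tX /= => /forallP wt.
  pose s := composition h (fun i => `|(tnth t i)%:Z - w i|%N).
  have sh : (\sum_i `|(tnth t i)%:Z - w i| = h)%N.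
    apply/eqP; rewrite -eqz_nat (big_morph _ PoszD (erefl _)).
    under eq_bigr => i _ do rewrite gez0_abs ?subr_ge0//.
    rewrite sumrB w0 subr0 -(big_morph _ PoszD (erefl _)) eqz_nat.
    by rewrite -mem_compositions.
  have sX : s \in X by apply: composition_in.
  have -> : weighted_sum t = weighted_sum s.
    apply/wsB => //; exists 1 => i.
    by rewrite tnth_composition// gez0_abs ?subr_ge0 ?wt// subKr mul1r.
  apply: IH => //; rewrite tnth_composition//; apply: leq_trans tn.
  by rewrite -ltz_nat gez0_abs ?subr_ge0 ?wt// ltrBlDr ltrDl.
rewrite size_seq_fset undup_id ?size_map -?cardE//.
rewrite map_inj_in_uniq ?enum_uniq// => t s.
by rewrite !mem_enum; exact: inj.
Qed.

End sumset_count.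

(** * Integer circuits *)

Lemma rbinom_nat (R : realType) (n k : nat) : (k <= n)%N ->
  rbinom n%:R k = 'C(n, k)%:R :> R.
Proof.
move=> kn; rewrite /rbinom; apply: (canLR (mulfK _)).
  by rewrite pnatr_eq0 -lt0n fact_gt0.
rewrite -natrM bin_ffact ffact_prod natr_prod; apply: eq_bigr => i _.
by rewrite natrB// (leq_trans (ltnW (ltn_ord i))).
Qed.

Section integer_circuit.
Context {d : nat} (v : 'I_d.+2 -> 'cV[int]_d).

Lemma minor_detE i : minor_det v i = \det (lift_mx (v \o lift i)).
Proof. by congr (\det _); apply/matrixP => k j; rewrite !mxE. Qed.

Lemma col'_lift_mx (K : comNzRingType) m (q : 'I_m -> 'cV[K]_d) i :
  col' i (lift_mx q) = lift_mx (q \o lift i).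
Proof. by apply/matrixP => k j; rewrite !mxE. Qed.

Lemma lift_mx_map (K : comNzRingType) m (q : 'I_m -> 'cV[int]_d) :
  lift_mx (fun j => map_mx intr (q j) : 'cV[K]_d) = map_mx intr (lift_mx q).
Proof.
apply/matrixP => k j; rewrite !mxE.
by case: unliftP => [i _|_]; rewrite ?mxE ?rmorph1.
Qed.

Lemma det_lift_mx_map (K : comNzRingType) i :
  \det (lift_mx ((fun j => map_mx intr (v j) : 'cV[K]_d) \o lift i)) =
  (minor_det v i)%:~R.
Proof. by rewrite (lift_mx_map _ (v \o lift i)) minor_detE det_map_mx. Qed.

(** The signed minors in primitive form; the division is exact because the gcd divides every
    minor. *)
Definition circuit_coef (i : 'I_d.+2) : int :=
  (((-1) ^+ i * minor_det v i) %/ minor_gcd v)%Z.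

Local Notation D := (minor_gcd v).
Local Notation w := circuit_coef.

Hypothesis D_i_neq0 : forall i, minor_det v i != 0.

Lemma minor_gcd_gt0 : 0 < D.
Proof.
rewrite lt_def biggcd_ge0 andbT; apply/eqP => D0.
have := dvdz_biggcd (minor_det v) ord0; rewrite -/D D0 dvd0z.
by apply/negP; exact: D_i_neq0.
Qed.

Lemma circuit_coefD i : w i * D = signed_minors (lift_mx v) i 0.
Proof.
rewrite mxE col'_lift_mx -minor_detE /w divzK// dvdz_mull//.
exact: dvdz_biggcd.
Qed.

Lemma signed_minorsE : signed_minors (lift_mx v) = D *: \col_i w i.
Proof.
by apply/colP => i; rewrite -circuit_coefD [RHS]mxE [in RHS]mxE mulrC.
Qed.

Lemma circuit_coef_neq0 i : w i != 0.
Proof.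
have : w i * D != 0.
  rewrite circuit_coefD mxE mulf_eq0 signr_eq0 col'_lift_mx -minor_detE.
  exact: D_i_neq0.
by apply: contra => /eqP ->; rewrite mul0r.
Qed.

Lemma lift_mx_circuit : lift_mx v *m (\col_i w i) = 0.
Proof.
have := mulmx_signed_minors (lift_mx v); rewrite signed_minorsE -scalemxAr.
move/colP => H; apply/colP => i; rewrite [RHS]mxE; apply/eqP.
have /eqP := H i; rewrite [X in X == _]mxE [X in _ == X]mxE mulf_eq0.
by rewrite gt_eqF ?minor_gcd_gt0.
Qed.

Lemma sum_circuit_coef : \sum_i w i = 0.
Proof.
have /lift_mx_kernel[+ _] := lift_mx_circuit.
by under eq_bigr do rewrite mxE.
Qed.

(** Nonzero entries with sum zero cannot all be nonpositive. *)
Lemma circuit_coef_pos : exists i, 0 < w i.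
Proof.
apply/existsP; apply: contraT; rewrite negb_exists => /forallP w_le0.
have : \sum_i - w i = 0 by rewrite sumrN sum_circuit_coef oppr0.
move/eqP; rewrite psumr_eq0 => [/allP/(_ ord0)|i _]; last first.
  by rewrite oppr_ge0 leNgt w_le0.
rewrite mem_index_enum oppr_eq0 => /(_ isT).
by rewrite (negbTE (circuit_coef_neq0 _)).
Qed.

Lemma normr_minor_det i : `|minor_det v i| = `|w i| * D.
Proof.
rewrite -[X in _ * X]gtr0_norm ?minor_gcd_gt0// -normrM circuit_coefD mxE.
by rewrite normrMsign col'_lift_mx -minor_detE.
Qed.

(* By Bezout, the coefficients [w i] have an integral combination equal to 1,
   so that the multiplier relating [x] to [w] is an integer. *)
Lemma integer_kernel (x : 'I_d.+2 -> int) : \sum_i x i = 0 ->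
  \sum_i v i *~ x i = 0 <-> exists k, forall i, x i = k * w i.
Proof.
move=> x0; pose X := \col_i x i; have XE i : X i 0 = x i by rewrite mxE.
have kerP : \sum_i v i *~ x i = 0 <-> lift_mx v *m X = 0.
  rewrite lift_mx_kernel.
  under [X in _ /\ X = 0]eq_bigr do rewrite XE -[x _]intz scaler_int.
  under [X in X = 0 /\ _]eq_bigr do rewrite XE.
  by split=> [|[]].
rewrite kerP; split=> [kX|[k kE]]; last first.
  have -> : X = k *: \col_i w i by apply/colP => i; rewrite !mxE.
  by rewrite -scalemxAr lift_mx_circuit scaler0.
(* [X] and [w] are both proportional to the signed minors; the common factor [D] cancels. *)
have cross i j : w i * x j = x i * w j.
  have := kernel_signed_minors (i := i) _ kX.
  rewrite col'_lift_mx -minor_detE => /(_ (D_i_neq0 i))/colP/(_ j).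
  rewrite [LHS]mxE [RHS]mxE !XE -!circuit_coefD mulrA mulrAC => /mulIf; apply.
  by rewrite gt_eqF ?minor_gcd_gt0.
have [c cD] := biggcd_bezout (minor_det v).
(* The Bezout coefficients of the minors take the sign [(-1)^i] carried by [w i]. *)
have c1 : \sum_i (c i * (-1) ^+ i) * w i = 1.
  apply: (@mulIf _ D); first by rewrite gt_eqF ?minor_gcd_gt0.
  rewrite mul1r -[RHS]cD mulr_suml; apply: eq_bigr => i _.
  rewrite -!mulrA circuit_coefD mxE col'_lift_mx -minor_detE; congr (_ * _).
  by rewrite mulrA -expr2 sqrr_sign mul1r.
exists (\sum_i (c i * (-1) ^+ i) * x i) => j.
rewrite -[LHS]mul1r -[in LHS]c1 !mulr_suml; apply: eq_bigr => i _.
by rewrite -!mulrA cross.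
Qed.

Section real_circuit.
Variable R : realType.
Let p j : 'cV[R]_d := map_mx intr (v j).

Lemma signed_minors_map i :
  signed_minors (lift_mx p) i 0 = (w i)%:~R * D%:~R.
Proof.
rewrite -intrM circuit_coefD !mxE !col'_lift_mx det_lift_mx_map -minor_detE.
by rewrite intrM rmorph_sign.
Qed.

Lemma volume_integer_circuit :
  volume (convex_hull (range p)) =
  ((\sum_i `|Num.max 0%R (w i)|)%N%:R * D%:~R / d`!%:R)%:E.
Proof.
have wR : lift_mx p *m (\col_i (w i)%:~R) = 0.
  rewrite lift_mx_map (_ : \col_i _ = map_mx intr (\col_i w i)).
    by rewrite -map_mxM lift_mx_circuit map_mx0.
  by apply/colP => i; rewrite !mxE.
have w0 : \sum_i (w i)%:~R = 0 :> R.
  have /lift_mx_kernel[+ _] := wR.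
  by rewrite (eq_bigr (fun i => (w i)%:~R))// => i _; rewrite mxE.
have wp : \sum_i (w i)%:~R *: p i = 0.
  have /lift_mx_kernel[_ +] := wR.
  by rewrite (eq_bigr (fun i => (w i)%:~R *: p i))// => i _; rewrite mxE.
rewrite (@volume_circuit _ _ _ (fun i => (w i)%:~R))//; first last.
- by move=> i; rewrite det_lift_mx_map intr_eq0.
- by have [i wi] := circuit_coef_pos; exists i; rewrite ltr0z.
(* Over the field [R] the multiplier is read off at the index [ord0], where [w] is nonzero. *)
- move=> x x0 xp; pose X := \col_i x i; have XE i : X i 0 = x i by rewrite mxE.
  have kX : lift_mx p *m X = 0.
    apply/lift_mx_kernel; split.
      by under eq_bigr do rewrite XE.
    by under eq_bigr do rewrite XE.
  have Ei : \det (col' ord0 (lift_mx p)) != 0.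
    by rewrite col'_lift_mx det_lift_mx_map intr_eq0.
  have cross j : (w ord0)%:~R * x j = x ord0 * (w j)%:~R.
    have /colP/(_ j) := kernel_signed_minors Ei kX.
    rewrite [LHS]mxE [RHS]mxE !XE !signed_minors_map mulrA mulrAC.
    move=> /mulIf; apply.
    by rewrite intr_eq0 gt_eqF ?minor_gcd_gt0.
  exists (x ord0 / (w ord0)%:~R) => j.
  rewrite mulrAC -cross mulrAC divff ?mul1r// intr_eq0.
  exact: circuit_coef_neq0.
rewrite sumEFin; congr EFin; rewrite -mulr_suml; congr (_ / _).
(* Extending the sum to all [i] replaces [w i] by its positive part. *)
rewrite natr_sum mulr_suml big_mkcond; apply: eq_bigr => i _.
rewrite ltr0z; case: (ltP 0 (w i)) => wi; last by rewrite absz0 mul0r.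
rewrite det_lift_mx_map -intr_norm normr_minor_det intrM; congr (_ * _).
Qed.

End real_circuit.
End integer_circuit.

(** * Sumsets of [d + 2] points in general position *)

Theorem theorem4p2 (R : realType) (d : nat) (v : 'I_d.+2 -> 'cV[int]_d)
    (A : {fset 'cV[int]_d}) :
  (1 <= d)%N ->
  injective v ->
  A = [fset v i | i in 'I_d.+2]%fset ->
  (forall (B : {fset 'cV[int]_d}) (H : set 'cV[R]_d),
      (B `<=` A)%fset -> #|` B| = d.+1 -> hyperplane H ->
      ~ (real_points R B `<=` H)) ->
  let T : R := fine (volume (convex_hull (real_points R A))) * d`!%:R
               / (minor_gcd v)%:~R in
  forall h : nat, (1 <= h)%N ->
    (h%:R < T ->
       #|` sumset h A| = 'C(h + d + 1, d + 1)%N) /\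
    (T <= h%:R ->
       #|` sumset h A|%:R =
         'C(h + d + 1, d + 1)%:R
         - rbinom (h%:R - T + d%:R + 1) (d + 1) :> R).
Proof.
move=> _ v_inj AE A_gen T h _.
(* A vanishing minor gives a nonzero row [a] killing the lifts of [d + 1] points of [A]: its entries
   are the coefficients of a hyperplane through them. *)
have D_i_neq0 i : minor_det v i != 0.
  rewrite -(intr_eq0 R) -det_lift_mx_map; apply/negP => /det0P[a a_neq0 a0].
  pose p j : 'cV[R]_d := map_mx intr (v j).
  have {}a0 j : \sum_k a 0 (lift ord_max k) * p (lift i j) k 0 = - a 0 ord_max.
    have /rowP/(_ j) := a0.
    rewrite !mxE (bigD1_ord ord_max)//= lift_mx_max mulr1.
    move/eqP; rewrite addrC addr_eq0 => /eqP <-.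
    by apply: eq_bigr => k _; rewrite lift_mx_lift.
  pose a' : 'rV[R]_d := \row_k a 0 (lift ord_max k).
  have a'E j : (a' *m p (lift i j)) 0 0 = - a 0 ord_max.
    by rewrite mxE -(a0 j); apply: eq_bigr => k _; rewrite [a' _ _]mxE.
  pose B : {fset 'cV[int]_d} := [fset v (lift i j) | j in 'I_d.+1]%fset.
  apply: (A_gen B [set x | (a' *m x) 0 0 = - a 0 ord_max]).
  - apply/fsubsetP => _ /imfsetP[j _ ->]; rewrite AE.
    by apply/imfsetP; exists (lift i j).
  - rewrite card_imfset; last exact: inj_comp v_inj lift_inj.
    by rewrite -cardE card_ord.
  - exists a', (- a 0 ord_max); split=> //.
    (* If the linear part vanished, evaluating at one of the points would make the last entry of [a]
       vanish too. *)
    apply: contra a_neq0 => /eqP a'0.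
    have amax : a 0 ord_max = 0.
      by apply: oppr_inj; rewrite oppr0 -(a'E ord0) a'0 mul0mx mxE.
    apply/eqP/rowP => k; rewrite [RHS]mxE.
    case: (unliftP ord_max k) => [k' ->|->//].
    by move/rowP: a'0 => /(_ k'); rewrite !mxE.
  - by move=> _ [_ /imfsetP[j _ ->] <-] /=; exact: a'E.
pose N := (\sum_i `|Num.max 0%R (circuit_coef v i)|)%N.
(* The threshold is a natural number, so both conditions on [h] become comparisons in [nat]. *)
have TE : T = N%:R.
  rewrite /T (_ : real_points R A = range (fun j => map_mx intr (v j))).
    rewrite volume_integer_circuit//= divfK ?pnatr_eq0 -?lt0n ?fact_gt0//.
    by rewrite mulfK// intr_eq0 gt_eqF ?minor_gcd_gt0.
  apply/seteqP; split => [_ [x /= + <-]|_ [j _ <-]].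
    by rewrite AE => /imfsetP[j _ ->]; exists j.
  by exists (v j) => //=; rewrite AE; apply/imfsetP; exists j.
have := card_sumset h AE (circuit_coef_pos D_i_neq0) (sum_circuit_coef D_i_neq0)
  (integer_kernel D_i_neq0).
have binE k : 'C(d.+1 + k, d.+1) = 'C(k + d + 1, d + 1).
  by rewrite !addn1 addSn addnC.
rewrite -/N TE ltr_nat ler_nat /= !binE => hA; split=> [hN|Nh].
  by move: hA; rewrite leqNgt hN addn0.
(* As [N <= h], the upper argument is a natural number at least [d + 1], where [rbinom] is the usual
   binomial. *)
rewrite -natrB// -[1]/(1%:R) -!natrD rbinom_nat; last first.
  by rewrite -addnA leq_addl.
by rewrite -hA Nh natrD addrK.
Qed.
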